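(* Let $G=(V,E)$ be a connected finite simple graph, let $B\subseteq E$ be its set of bridges, and let $S\subseteq V$ be the set of isolated vertices of $G-B$. If $S=\emptyset$ and every two-edge connected component of $G-B$ is all-round, then $G$ is all-round.
   Context: A bridge is an edge whose removal disconnects the graph. For a graph $H=(V,E)$ and $f\colon V\to\{0,1,2,3\}$, a connected mod-4 $f$-factor is a vector $\mathbf{x}\in\{0,1,2,3\}^E$ with $\sum_{e\in\delta(v)}x_e\equiv f(v)\pmod 4$ for all $v\in V$ ($\delta(v)$ = edges incident to $v$) such that the graph $(V,\{e\in E\mid x_e>0\})$ is connected. $H$ is all-round if it has a connected mod-4 $f$-factor for every $f\colon V\to\{0,1,2,3\}$ with $\sum_{v\in V}f(v)$ even. *)

(* Defs.v *)
From mathcomp Require Import all_boot.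

Set Implicit Arguments.
Unset Strict Implicit.
Unset Printing Implicit Defensive.

(* A finite simple graph whose vertices are taken in an ambient finType T: a
   vertex set, and a set of edges that are two-element sets of vertices.
   Vertex sets need not be all of T, so a graph and its subgraphs share one
   type. *)
Record sgraph (T : finType) := SGraph {
  vertices : {set T};
  edges : {set {set T}};
  edgesP : [forall e in edges, (e \subset vertices) && (#|e| == 2)]
}.

Section SimpleGraphs.
Variable T : finType.
Implicit Types (G H K : sgraph T) (F : {set {set T}}) (v : T) (e : {set T}).

Lemma spanning_edgesP G F :
  [forall e in edges G :&: F, (e \subset vertices G) && (#|e| == 2)].
Proof.
apply/forall_inP => e; rewrite inE => /andP[eG _].
exact: (forall_inP (edgesP G)).
Qed.

Definition spanning G F : sgraph T := SGraph (spanning_edgesP G F).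

Definition del_edges G F : sgraph T := spanning G (~: F).

Definition adj G : rel T := [rel u v | [set u; v] \in edges G].

Definition connected G : bool :=
  (vertices G != set0) &&
  [forall u in vertices G, forall v in vertices G, connect (adj G) u v].

(* On a disconnected graph every edge would count; used for connected G only. *)
Definition bridges G : {set {set T}} :=
  [set e in edges G | ~~ connected (del_edges G [set e])].

Definition isolated G : {set T} :=
  [set v in vertices G | [forall e in edges G, v \notin e]].

Definition subgraph H G : bool :=
  (vertices H \subset vertices G) && (edges H \subset edges G).

(* A single vertex does not count as two-edge connected; this is immaterial for
   two_edge_component in a graph without isolated vertices. *)
Definition two_edge_connected G : bool :=
  [&& 1 < #|vertices G|, connected G & bridges G == set0].

(* A maximal two-edge connected subgraph. *)
Definition two_edge_component G K : Prop :=
  [/\ subgraph K G,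
      two_edge_connected K
    & forall H, subgraph H G -> two_edge_connected H ->
        subgraph K H -> subgraph H K].

(* Only the values of x on the edges of G, and of f on the vertices of G, are
   used. *)
Definition connected_mod4_factor G (f : T -> 'I_4) (x : {set T} -> 'I_4)
    : Prop :=
  (forall v, v \in vertices G ->
     \sum_(e in edges G | v \in e) x e = f v %[mod 4]) /\
  connected (spanning G [set e | 0 < x e]).

Definition all_round G : Prop :=
  forall f : T -> 'I_4, ~~ odd (\sum_(v in vertices G) f v) ->
    exists x : {set T} -> 'I_4, connected_mod4_factor G f x.

End SimpleGraphs.

(* Main.v *)
Require Import Defs.
From mathcomp Require Import all_boot.

(** Pick integer weights y on the edges of G whose sum at every vertex v has the
    parity of f v; such y exist because G is connected and the sum of f is even.
    Give each bridge e the value 1 or 2, according to the parity of y e, and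
    subtract the bridge contributions from f.  Modulo 2, the new demand on a
    component of G - B is the degree sum of y over the non-bridge edges, and
    every such edge lies inside one component and is counted there twice, so
    the demand is even.  Since components are all-round, their connected
    factors complete the values on the bridges; as bridges carry non-zero values
    and every component stays connected, the support spans G connectedly. *)

Set Implicit Arguments.
Unset Strict Implicit.
Unset Printing Implicit Defensive.

Lemma odd_sum (I : finType) (P : pred I) (m n : I -> nat) :
  (forall i, P i -> odd (m i) = odd (n i)) ->
  odd (\sum_(i | P i) m i) = odd (\sum_(i | P i) n i).
Proof.
by move=> mn; rewrite !(big_morph odd oddD (erefl : odd 0 = false)); apply: eq_bigr.
Qed.

(** * Walks along an edge set, and edge weights with prescribed parities *)

Section Links.
Variable T : finType.
Implicit Types (F D : {set {set T}}) (u v w : T) (e : {set T}).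

(** Based on a bare edge set, so that edges can be deleted without building a new graph;
    [link (edges G)] is convertible to [adj G]. *)
Definition link F : rel T := fun u v => [set u; v] \in F.

Lemma link_sym F : symmetric (link F).
Proof. by move=> u v; rewrite /link setUC. Qed.

Lemma connect_link_sym F : connect_sym (link F).
Proof. exact: sym_connect_sym (@link_sym F). Qed.

Lemma connect_link_sub F D u v :
  F \subset D -> connect (link F) u v -> connect (link D) u v.
Proof.
move=> /subsetP FD; apply: connect_sub => a b /= ab.
by apply: connect1; apply: FD.
Qed.

(** The parts of a walk before its first and after its last use of the edge survive the deletion. If
    both stop at the same end of the edge, they join up to a walk from [u] to [v]. *)
Lemma connect_link_delete F c d u v :
  connect (link F) u v ->
  let R := connect (link (F :\ [set c; d])) in
  [|| R u v, R u c && R d v | R u d && R c v].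
Proof.
move=> /connectP[p]; elim: p u => [|a p IHp] u /=.
  by move=> _ ->; rewrite connect0.
move=> /andP[ua pa] vE; have {IHp} := IHp a pa vE; cbv zeta.
set R := connect _.
have [ecd|ncd] := eqVneq [set u; a] [set c; d]; last first.
  have Rua : R u a by apply: connect1; rewrite /link /= !inE ncd.
  by case/or3P=> [|/andP[]|/andP[]] => /(connect_trans Rua); rewrite -/R => ->;
    rewrite ?orbT // => ->; rewrite ?orbT.
have ucd : (u == c) || (u == d) by have := set21 u a; rewrite ecd !inE.
have acd : (a == c) || (a == d) by have := set22 u a; rewrite ecd !inE.
have cua : (c == u) || (c == a) by have := set21 c d; rewrite -ecd !inE.
have dua : (d == u) || (d == a) by have := set22 c d; rewrite -ecd !inE.
have R0 x : R x x by exact: connect0.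
have RC x y : R x y = R y x by exact: connect_link_sym.
case/orP: ucd => /eqP uE; subst u.
  case/orP: acd => /eqP aE; subst a.
    (* Both ends of the step are [c], so the pair is degenerate and [d = c]. *)
    by move: dua; rewrite orbb => /eqP ->; rewrite !R0 /= !orbb.
  by case/or3P=> [->|/andP[_ ->]|/andP[_ ->]]; rewrite ?R0 ?orbT.
case/orP: acd => /eqP aE; subst a.
  by case/or3P=> [->|/andP[_ ->]|/andP[_ ->]]; rewrite ?R0 ?orbT.
by move: cua; rewrite orbb => /eqP ->; rewrite !R0 /= !orbb.
Qed.

(** Weigh each edge by the number of times a walk from [u] to [v] uses it: every inner visit to a
    vertex adds 2 to the sum there. *)
Lemma path_weights F u v : (forall e, e \in F -> #|e| = 2) ->
  connect (link F) u v ->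
  exists y : {set T} -> nat,
    forall w, odd (\sum_(e in F | w \in e) y e) = (w == u) (+) (w == v).
Proof.
move=> F2 /connectP[p]; elim: p u => [|a p IHp] u /=.
  by move=> _ ->; exists (fun=> 0) => w; rewrite sum_nat_const muln0 addbb.
move=> /andP[ua pa] vE; have {IHp} [y yP] := IHp a pa vE.
(* The new first edge flips the parity at [u] and at [a]; the flip at [a] cancels the one from the
   rest of the walk. *)
exists (fun e => y e + (e == [set u; a])) => w.
have uaF : [set u; a] \in F := ua.
have neq_ua : u != a by have := F2 _ uaF; rewrite cards2; case: (u != a).
rewrite big_split oddD yP addbC.
have -> : \sum_(e in F | w \in e) (e == [set u; a] : nat) = (w \in [set u; a]).
  have [w_ua|w_ua] := boolP (w \in [set u; a]).
    rewrite (bigD1 [set u; a]) /= ?uaF ?eqxx ?w_ua // big1 // => e.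
    by case/andP=> _ /negPf ->.
  rewrite big1 // => e /andP[_ we]; apply/eqP; rewrite eqb0.
  by apply: contraNneq w_ua => <-.
rewrite oddb !inE; have [->|_] := eqVneq w u; first by rewrite (negPf neq_ua).
by rewrite addbA addbb.
Qed.

(** Superpose, for each [v] in [A], [f v] copies of a walk from [r] to [v]. The ends at [r] add up
    to the even total of [f], so only the ends at [v] affect parities. *)
Lemma parity_weights (A : {set T}) F (f : T -> nat) (r : T) :
    (forall e, e \in F -> #|e| = 2) ->
    {in A, forall v, connect (link F) r v} ->
    ~~ odd (\sum_(v in A) f v) ->
  exists y : {set T} -> nat,
    {in A, forall w, odd (\sum_(e in F | w \in e) y e) = odd (f w)}.
Proof.
move=> F2 conn evf.
have /fin_all_exists[Y YP] : forall v, exists y : {set T} -> nat, v \in A ->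
    forall w, odd (\sum_(e in F | w \in e) y e) = (w == r) (+) (w == v).
  move=> v; have [vA|_] := boolP (v \in A); last by exists (fun=> 0).
  by have [y yP] := path_weights F2 (conn v vA); exists y.
exists (fun e => \sum_(v in A) f v * Y v e) => w wA.
rewrite exchange_big /=.
under eq_bigr do rewrite -big_distrr /=.
rewrite (@odd_sum _ _ _ (fun v => (w == r) * f v + (v == w) * f v)); last first.
  move=> v vA; rewrite oddM YP // oddD !oddM !oddb (eq_sym v w).
  by case: (w == r); case: (w == v); case: (odd _).
rewrite big_split /= oddD -big_distrr /= oddM (negPf evf) andbF /=.
by rewrite (bigD1 w) //= eqxx mul1n big1 ?addn0 // => v /andP[_ /negPf ->].
Qed.

End Links.

(** * Connected graphs and the deletion of one edge *)

Section Connectedness.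
Variable T : finType.
Implicit Types (G : sgraph T) (u v w : T) (e : {set T}).

Lemma edge_sub G e : e \in edges G -> e \subset vertices G.
Proof. by move=> /(forall_inP (edgesP G))/andP[]. Qed.

Lemma edge_card G e : e \in edges G -> #|e| = 2.
Proof. by move=> /(forall_inP (edgesP G))/andP[_ /eqP]. Qed.

Lemma edge_pair G e : e \in edges G -> exists u v, e = [set u; v].
Proof. by move=> /edge_card/eqP/cards2P[u [v [_ ->]]]; exists u, v. Qed.

Lemma connected_from G v : v \in vertices G ->
  {in vertices G, forall w, connect (link (edges G)) v w} -> connected G.
Proof.
move=> vG conn; apply/andP; split; first by apply/set0Pn; exists v.
apply/forall_inP=> a aG; apply/forall_inP=> b bG.
by apply: connect_trans (conn b bG); rewrite connect_link_sym; apply: conn.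
Qed.

Lemma connectedP G : connected G ->
  {in vertices G &, forall u v, connect (link (edges G)) u v}.
Proof. by case/andP=> _ /forall_inP conn u v /conn /forall_inP; apply. Qed.

(** Any walk through the deleted edge can be rerouted along the remaining walk from [c] to [d].
    Hence removing a bridge separates its ends. *)
Lemma connected_del_edge G c d :
  connected G -> connect (link (edges G :\ [set c; d])) c d ->
  connected (del_edges G [set [set c; d]]).
Proof.
move=> connG cd; have /andP[/set0Pn[v vG] _] := connG.
apply: (@connected_from _ v) => // w wG; rewrite [edges _]/= -setDE.
have /or3P[//|/andP[vc dw]|/andP[vd cw]] :=
  connect_link_delete c d (connectedP connG vG wG).
  exact: connect_trans vc (connect_trans cd dw).
by apply: connect_trans vd (connect_trans _ cw); rewrite connect_link_sym.
Qed.

End Connectedness.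

(** * The components left after the removal of all bridges *)

Section BridgeComponents.
Variables (T : finType) (G : sgraph T).
Hypothesis G_connected : connected G.
Implicit Types (u v w : T) (e : {set T}).

Let D := edges G :\: bridges G.

Let edge_D e : e \in D -> e \in edges G.
Proof. by rewrite inE => /andP[]. Qed.

(** Bridges are deleted one at a time. If deleting [[set c; d]] cut [a] from [b], these would still
    reach different ends of it; together with the edge [[set a; b]] of [G] they would join [c] to
    [d] without [[set c; d]], which then would not be a bridge. *)
Lemma connect_delete_bridges (s : seq {set T}) (F : {set {set T}}) a b :
    F \subset edges G :\ [set a; b] -> [set a; b] \in D ->
    {subset s <= bridges G} -> connect (link F) a b ->
  connect (link (F :\: [set:: s])) a b.
Proof.
move=> + abD; elim: s F => [|e s IHs] F FE sB ab.
  by rewrite set_nil setD0.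
have eB : e \in bridges G by apply: sB; rewrite mem_head.
have sB' : {subset s <= bridges G} by move=> x xs; apply: sB; rewrite inE xs orbT.
rewrite set_cons -setDDl; apply: IHs sB' _; first exact: subset_trans (subsetDl _ _) FE.
have /[!inE]/andP[eG nconn] := eB.
have [c [d eE]] := edge_pair eG; subst e.
have sub : F :\ [set c; d] \subset edges G :\ [set c; d].
  by apply: setSD; apply: subset_trans FE (subsetDl _ _).
have abG : connect (link (edges G :\ [set c; d])) a b.
  apply: connect1; rewrite /link !inE edge_D // andbT.
  by apply: contraTneq abD => ->; rewrite in_setD eB.
have [//|wit] := boolP (connect (link (F :\ [set c; d])) a b).
case/negP: nconn; apply: connected_del_edge => //.
have /or3P[ab'|/andP[ac db]|/andP[ad cb]] := connect_link_delete c d ab.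
- by rewrite ab' in wit.
- move: ac db => /(connect_link_sub sub) ac /(connect_link_sub sub) db.
  rewrite connect_link_sym in ac; rewrite connect_link_sym in db.
  exact: connect_trans ac (connect_trans abG db).
- move: ad cb => /(connect_link_sub sub) ad /(connect_link_sub sub) cb.
  rewrite connect_link_sym in abG.
  exact: connect_trans cb (connect_trans abG ad).
Qed.

(** As [connect] is reflexive on all of [T], membership in [vertices G] is imposed to exclude a root
    outside the graph. *)
Definition comp_vertices r := [set w in vertices G | connect (link D) r w].
Definition comp_edges r := [set e in D | e \subset comp_vertices r].

Fact comp_edgesP r :
  [forall e in comp_edges r, (e \subset comp_vertices r) && (#|e| == 2)].
Proof.
apply/forall_inP=> e; rewrite inE => /andP[eD ->].
by rewrite (edge_card (edge_D eD)).
Qed.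

Definition comp r : sgraph T := SGraph (comp_edgesP r).

Lemma comp_edge_sub r v e :
  v \in comp_vertices r -> e \in D -> v \in e -> e \subset comp_vertices r.
Proof.
rewrite inE => /andP[vG rv] eD ve; apply/subsetP=> w we.
have eG := edge_D eD; rewrite inE (subsetP (edge_sub eG)) //=.
have [-> //|neq] := eqVneq w v.
apply: connect_trans rv (connect1 _); rewrite /link.
suff <- : e = [set v; w] by [].
apply/esym/eqP; rewrite eqEcard (edge_card eG) cards2 eq_sym neq andbT.
by rewrite subUset !sub1set ve we.
Qed.

Lemma comp_edges_at r v e : v \in comp_vertices r -> v \in e ->
  (e \in comp_edges r) = (e \in D).
Proof.
move=> vr ve; rewrite inE; have [eD|//] := boolP (e \in D).
by rewrite (comp_edge_sub vr).
Qed.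

(** Edges of [D] never leave a component, so neither does the walk. A general [F] allows one further
    edge to be removed from [D]. *)
Lemma connect_comp r (F : {set {set T}}) v w :
    F \subset D -> v \in comp_vertices r -> connect (link F) v w ->
  connect (link (F :&: comp_edges r)) v w.
Proof.
move=> /subsetP FD vr /connectP[p]; elim: p v vr => [|a p IHp] v vr /=.
  by move=> _ ->; rewrite connect0.
case/andP=> va pa wE.
have ea : [set v; a] \subset comp_vertices r.
  by apply: comp_edge_sub vr (FD _ va) _; rewrite set21.
apply: connect_trans (IHp a _ pa wE); last by apply: (subsetP ea); rewrite set22.
by apply: connect1; rewrite /link in_setI -/(link F v a) va inE ea andbT; apply: FD.
Qed.

Lemma comp_connect r v w : v \in comp_vertices r -> w \in comp_vertices r ->
  connect (link D) v w.
Proof.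
rewrite !inE => /andP[_ rv] /andP[_ rw].
by apply: connect_trans rw; rewrite connect_link_sym.
Qed.

Lemma comp_id r : r \in vertices G -> r \in comp_vertices r.
Proof. by move=> rG; rewrite inE rG connect0. Qed.

Lemma comp_connected r : r \in vertices G -> connected (comp r).
Proof.
move=> rG; apply: (@connected_from _ _ r) => [|w wr]; first exact: comp_id.
have rw := comp_connect (comp_id rG) wr.
by apply: connect_link_sub (connect_comp (subxx D) (comp_id rG) rw); apply: subsetIr.
Qed.

Lemma comp_bridgeless r : r \in vertices G -> bridges (comp r) = set0.
Proof.
move=> rG; apply/setP=> e; rewrite in_set0 inE; apply/negP=> /andP[].
rewrite inE => /andP[eD er]; have eG := edge_D eD; have [a [b eE]] := edge_pair eG; subst e.
case/negP; apply: connected_del_edge; first exact: comp_connected.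
have ar : a \in comp_vertices r by apply: (subsetP er); rewrite set21.
have : connect (link (D :\ [set a; b])) a b.
  (* Removing the edge first and the bridges second lets the non-bridge property of [[set a; b]] in
     [G] supply the initial walk. *)
  have -> : D :\ [set a; b] = (edges G :\ [set a; b]) :\: [set:: enum (bridges G)].
    by rewrite set_enum !setDDl setUC.
  apply: connect_delete_bridges => //; first by move=> e; rewrite mem_enum.
  have /setDP[_] := eD; rewrite inE eG negbK => conn.
  have := @connectedP _ _ conn a b; rewrite /= -setDE; apply.
    by apply: (subsetP (edge_sub eG)); rewrite set21.
  by apply: (subsetP (edge_sub eG)); rewrite set22.
move=> /(connect_comp (subsetDl _ _) ar); apply: connect_link_sub.
by apply/subsetP=> e; rewrite !inE => /andP[/andP[-> _]].
Qed.

Lemma comp_two_edge_component r :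
    isolated (del_edges G (bridges G)) = set0 -> r \in vertices G ->
  two_edge_component (del_edges G (bridges G)) (comp r).
Proof.
move=> noniso rG; split.
- apply/andP; split; first by apply/subsetP=> w; rewrite inE => /andP[].
  by rewrite /= -setDE; apply/subsetP=> e; rewrite inE => /andP[].
- rewrite /two_edge_connected comp_connected // comp_bridgeless // eqxx !andbT.
  (* Since [r] is not isolated, it lies on an edge of [D], whose two ends belong to the
     component. *)
  have := in_set0 r; rewrite -noniso inE rG /= => /negbT.
  rewrite -setDE negb_forall_in => /exists_inP[e eD]; rewrite negbK => re.
  rewrite -(edge_card (edge_D eD)); apply: subset_leq_card.
  exact: comp_edge_sub (comp_id rG) eD re.
(* Maximality: a connected subgraph of [G - B] that contains [r] only has vertices reachable from
   [r] along [D]. *)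
- move=> H /andP[HV HE] /and3P[_ Hc _] /andP[KV KE]; rewrite /= -setDE in HV HE.
  have rH : r \in vertices H by apply: (subsetP KV); apply: comp_id.
  have HK : vertices H \subset comp_vertices r.
    apply/subsetP=> w wH; rewrite inE (subsetP HV) //=.
    by apply: connect_link_sub HE _; apply: connectedP.
  apply/andP; split=> //; apply/subsetP=> e eH.
  by rewrite inE (subsetP HE) //=; apply: subset_trans HK; apply: edge_sub.
Qed.

(** Handshake count: after exchanging the sums, an edge of [D] contributes [2 * y e] if it meets the
    component, and 0 otherwise. *)
Lemma even_comp_degree_sum r (y : {set T} -> nat) :
  ~~ odd (\sum_(v in comp_vertices r) \sum_(e in D | v \in e) y e).
Proof.
rewrite (exchange_big_dep (mem D)) /=; last by move=> ? ? _ /andP[].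
rewrite (@odd_sum _ _ _ (fun=> 0)) ?big1 // => e eD.
have [/existsP[v /andP[vr ve]]|none] := boolP [exists v in comp_vertices r, v \in e].
  rewrite (eq_bigl (mem e)); last first.
    move=> w; rewrite eD /=; have [we|] := boolP (w \in e); last by rewrite andbF.
    by rewrite andbT (subsetP (comp_edge_sub vr eD ve)).
  by rewrite sum_nat_const (edge_card (edge_D eD)) mul2n odd_double.
rewrite big_pred0 // => v; apply: contraNF none => /and3P[vr _ ve].
by apply/existsP; exists v; rewrite vr.
Qed.

(* A factor of each component, chosen at its root, gives values on all of D. *)
Definition glue (X : T -> {set T} -> 'I_4) (xB : {set T} -> 'I_4) e : 'I_4 :=
  if e \in bridges G then xB e
  else if [pick v in e] is Some v then X (root (link D) v) e else ord0.

(** The end picked by [glue] may differ from [v], but both ends lie in one component and so have the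
    same root. *)
Lemma glueE X xB v e : v \in e -> e \in D ->
  glue X xB e = X (root (link D) v) e.
Proof.
move=> ve eD; have /setDP[eG /negPf eB] := eD; rewrite /glue eB.
case: pickP => [w we|/(_ v)]; last by rewrite ve.
have vv : v \in comp_vertices v by apply/comp_id/(subsetP (edge_sub eG)).
congr (X _ e); apply/esym/(rootP (@connect_link_sym _ D)).
by have := subsetP (comp_edge_sub vv eD ve) w we; rewrite inE => /andP[].
Qed.

End BridgeComponents.

(** * Assembling a connected factor of the whole graph *)

Theorem theorem5p1 (T : finType) (G : sgraph T)
  (G_connected : connected G)
  (no_isolated : isolated (del_edges G (bridges G)) = set0)
  (components_all_round : forall K : sgraph T,
     two_edge_component (del_edges G (bridges G)) K -> all_round K) :
  all_round G.
Proof.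
move=> f evf; set B := bridges G; set D := edges G :\: B.
have /andP[/set0Pn[r0 r0G] _] := G_connected.
have [y yP] := @parity_weights _ _ _ (fun v => f v) r0 (@edge_card _ G)
  (fun v vG => connectedP G_connected r0G vG) evf.
pose xB e : 'I_4 := inord (if odd (y e) then 1 else 2).
have xBE e : xB e = (if odd (y e) then 1 else 2) :> nat.
  by rewrite inordK //; case: odd.
pose s v := \sum_(e in B | v \in e) xB e.
have splitE (F : {set T} -> nat) v : \sum_(e in edges G | v \in e) F e =
    \sum_(e in B | v \in e) F e + \sum_(e in D | v \in e) F e.
  rewrite (bigID (mem B)) /=; congr (_ + _); apply: eq_bigl => e.
    have [eB|_] := boolP (e \in B); last by rewrite andbF.
    by rewrite andbT; move: eB; rewrite inE => /andP[->].
  by rewrite in_setD [LHS]andbAC [_ && (e \notin B)]andbC.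
(* [3 * s v] stands for [- s v] modulo 4. *)
pose f' v : 'I_4 := inord ((f v + 3 * s v) %% 4).
have f'E v : f' v = (f v + 3 * s v) %% 4 :> nat by rewrite inordK // ltn_pmod.
have f'_odd : {in vertices G, forall v,
    odd (f' v) = odd (\sum_(e in D | v \in e) y e)}.
  (* Modulo 2, [f' v] is [f v + s v]. The degree sum of [y] at [v] has the parity of [f v], and its
     bridge part, having that of [s v], cancels. *)
  move=> v vG; rewrite f'E odd_mod // oddD oddM -yP // splitE oddD /=.
  have -> : odd (s v) = odd (\sum_(e in B | v \in e) y e).
    by apply: odd_sum => e _; rewrite xBE; case: (odd (y e)).
  by rewrite addbAC addbb.
have /fin_all_exists[X XP] : forall r, exists x : {set T} -> 'I_4,
    r \in vertices G -> connected_mod4_factor (comp G r) f' x.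
  move=> r; have [rG|_] := boolP (r \in vertices G); last by exists (fun=> ord0).
  have [|x xP] := components_all_round _
    (comp_two_edge_component G_connected no_isolated rG) f'; last by exists x.
  rewrite (@odd_sum _ _ _ (fun v => \sum_(e in D | v \in e) y e)).
    exact: even_comp_degree_sum.
  by move=> v; rewrite inE => /andP[vG _]; apply: f'_odd.
(* Canonical roots make all edges of a component take their values from the same factor. *)
pose R := root (link D).
have symD := @connect_link_sym _ D.
have RG v : v \in vertices G -> R v \in vertices G.
  move=> vG; have /connectP[p] := connect_root (link D) v.
  rewrite -/(R v); elim/last_ind: p => [_ -> //|p a _].
  rewrite rcons_path last_rcons => /andP[_ ea] ->.
  have /setDP[eG _] := ea; apply: (subsetP (edge_sub eG)); exact: set22.
have Rcomp v : v \in vertices G -> v \in comp_vertices G (R v).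
  by move=> vG; rewrite inE vG /= symD; apply: connect_root.
pose x := glue G X xB; exists x; split.
  move=> v vG; rewrite splitE.
  have -> : \sum_(e in B | v \in e) x e = s v.
    by apply: eq_bigr => e /andP[eB _]; rewrite /x /glue eB.
  (* Every non-bridge edge at [v] lies in the component of [R v]. *)
  have -> : \sum_(e in D | v \in e) x e =
      \sum_(e in edges (comp G (R v)) | v \in e) X (R v) e.
    apply: eq_big => [e|e /andP[eD ve]]; last by rewrite /x (glueE _ _ ve eD).
    have [ve|] := boolP (v \in e); last by rewrite !andbF.
    by rewrite !andbT /= (comp_edges_at (Rcomp v vG)).
  have [XE _] := XP _ (RG v vG).
  rewrite -modnDmr XE ?Rcomp // f'E modn_mod modnDmr.
  (* The bridge total now occurs as [s v + 3 * s v], a multiple of 4. *)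
  by rewrite addnCA -mulSn mulnC addnC modnMDl.
apply: (@connected_from _ _ r0) => // w wG.
(* It suffices to join the ends of each edge of [G] within the support: a bridge is itself in the
   support, and any other edge is replaced by a walk in the support of its component's factor. *)
apply: connect_sub (connectedP G_connected r0G wG) => a b /= abG.
have aG : a \in vertices G by apply: (subsetP (edge_sub abG)); rewrite set21.
have bG : b \in vertices G by apply: (subsetP (edge_sub abG)); rewrite set22.
have [abB|abB] := boolP ([set a; b] \in B).
  by apply: connect1; rewrite /link /= in_setI -/(link _ a b) abG inE /x /glue abB xBE; case: odd.
have abD : [set a; b] \in D by rewrite inE abB.
have [_ /connectedP conn] := XP _ (RG a aG).
have bR : b \in comp_vertices G (R a).
  by apply: (subsetP (comp_edge_sub (Rcomp a aG) abD (set21 _ _))); rewrite set22.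
apply: connect_link_sub (conn a b (Rcomp a aG) bR).
apply/subsetP=> e /setIP[eK]; rewrite !inE.
have eD : e \in D by move: eK; rewrite inE => /andP[].
have /setDP[-> _] := eD.
have [u [v eE]] := edge_pair (subsetP (subsetDl _ _) _ eD).
have ue : u \in e by rewrite eE set21.
rewrite /x (glueE _ _ ue eD).
(* The edge lies in the component of [R a], so [glue] reads its value from [X (R a)], which is
   positive there. *)
suff -> : root (link (edges G :\: bridges G)) u = R a by [].
rewrite -/D -/B -/D -[R a](root_root symD); apply/(rootP symD).
move: eK; rewrite inE => /andP[_ /subsetP/(_ u ue)]; rewrite inE => /andP[_].
by rewrite symD.
Qed.
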